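(* Let $\gamma:\mathbb{R}^2\to\mathbb{R}^{2,1}$ be a smooth space-like solution of the $\ast$-MCF $\gamma_t=-\frac12\ast_\gamma H(\gamma)$ parametrized by arc-length, $g=(e_0,e_1,e_2)$ an adapted null p-frame along $\gamma$ with null principal curvatures $k_1,k_2$, and $q=-\frac{k_1}2$, $r=\frac{k_2}2$, which satisfy $q_t=-\frac12(q_{xx}-2q^2r)$, $r_t=\frac12(r_{xx}-2qr^2)$. Let $\alpha_1\ne\alpha_2$ be nonzero real constants, and let $\xi_1=(y_1,y_2)^t$ and $\xi_2=(y_3,y_4)^t$ be $\mathbb R^2$-valued solutions, with $\alpha=\alpha_1$ and $\alpha=\alpha_2$ respectively, of the linear system $$\xi_x=-\begin{pmatrix} \alpha & q \\ {r} & -\alpha \end{pmatrix}\xi,\qquad \xi_t=-\begin{pmatrix} \alpha^2-\frac12qr & \alpha q-\frac12q_x \\ \alpha r+\frac12r_x & -\alpha^2+\frac12qr \end{pmatrix}\xi.$$ Suppose $\xi_1,\xi_2$ are linearly independent at every point, and let $Y=\begin{pmatrix} y_1 & y_3 \\ {y_2} & y_4 \end{pmatrix}$. Then $$\tilde\gamma=\gamma+\left(\frac1{\alpha_1}-\frac1{\alpha_2}\right)\frac1{\det(Y)}\left(\frac{y_1y_4+y_2y_3}{2}e_0-y_1y_3e_1+y_2y_4e_2\right)$$ is a solution of the space-like $\ast$-MCF $\tilde\gamma_t=-\frac12\ast_{\tilde\gamma}H(\tilde\gamma)$ on $\mathbb{R}^{2,1}$.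
   Context: $\mathbb{R}^{2,1}$ is $\mathbb{R}^3$ with $\langle v,w\rangle=v^tD_3w$, where $D_3=\begin{pmatrix} 1 & 0 & 0 \\ 0 & 0 & \frac12 \\ 0 & \frac12 & 0 \end{pmatrix}$ (equivalently $sl(2,\mathbb{R})$ with $\frac12\mathrm{tr}(XY)$ and ordered basis $\mathrm{diag}(1,-1),e_{12},e_{21}$). $O(3,D_3)=\{A:A^tD_3A=D_3\}$; frames are taken with determinant $1$. For a space-like curve with $\langle\gamma_x,\gamma_x\rangle=1$, $H(\gamma)=\gamma_{xx}$, and for any frame $(e_0,e_1,e_2)\in O(3,D_3)$ of determinant $1$ with $e_0=\gamma_x$ the Hodge star of the normal plane is $\ast_\gamma e_1=e_1$, $\ast_\gamma e_2=-e_2$. An adapted null p-frame along a solution $\gamma$ is a smooth map $g=(e_0,e_1,e_2):\mathbb{R}^2\to O(3,D_3)$ (determinant $1$) with $e_0=\gamma_x$ and $$g^{-1}g_x=\begin{pmatrix} 0 & -\frac{k_2}{2} & -\frac{k_1}{2} \\ {k_1} & 0 & 0 \\ {k_2} & 0 & 0 \end{pmatrix},\qquad g^{-1}g_t=\frac14\begin{pmatrix} 0 & -(k_2)_x & (k_1)_x \\ -2(k_1)_x & k_1k_2 & 0 \\ 2(k_2)_x & 0 & -k_1k_2 \end{pmatrix}.$$ *)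

(* Defs.v *)
From HB Require Import structures.
From mathcomp Require Import all_boot all_order all_algebra.
From mathcomp Require Import ring lra.
From mathcomp Require Import all_classical all_reals all_analysis.

Set Implicit Arguments.
Unset Strict Implicit.
Unset Printing Implicit Defensive.

Import Order.TTheory GRing.Theory Num.Theory.
Import numFieldNormedType.Exports.

Local Open Scope classical_set_scope.
Local Open Scope ring_scope.

(* Functions on R^2 are curried, f x t, with x the curve parameter and t the
   time. *)
Definition dx (R : realType) (V : normedModType R) (f : R -> R -> V)
  : R -> R -> V := fun x t => derive1 (fun s => f s t) x.

Definition dt (R : realType) (V : normedModType R) (f : R -> R -> V)
  : R -> R -> V := fun x t => derive1 (f x) t.

(* Class C^n on R^2: joint continuity, and existence and class C^(n-1) of both
   partial derivatives. *)
Fixpoint class_C (R : realType) (V : normedModType R) (n : nat)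
    (f : R -> R -> V) : Prop :=
  continuous (fun p : R * R => f p.1 p.2) /\
  if n is m.+1 then
    [/\ forall x t, derivable (fun s => f s t) x 1,
        forall x t, derivable (f x) t 1,
        class_C m (dx f) & class_C m (dt f)]
  else True.

Definition smooth (R : realType) (V : normedModType R) (f : R -> R -> V) : Prop :=
  forall n, class_C n f.

Definition mx2 (R : realType) (a b c d : R) : 'M[R]_2 :=
  \matrix_(i, j) nth 0 (nth [::] [:: [:: a; b]; [:: c; d]] i) j.

Definition mx3 (R : realType) (a b c d e f g h k : R) : 'M[R]_3 :=
  \matrix_(i, j)
    nth 0 (nth [::] [:: [:: a; b; c]; [:: d; e; f]; [:: g; h; k]] i) j.

Definition D3 (R : realType) : 'M[R]_3 :=
  mx3 1 0    0
      0 0    2^-1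
      0 2^-1 0.

Definition lorentz (R : realType) (v w : 'cV[R]_3) : R :=
  (v^T *m D3 R *m w) 0 0.

Definition e_ (R : realType) (i : nat) (E : 'M[R]_3) : 'cV[R]_3 :=
  col (inord i) E.
Arguments e_ {R} i%_N E.

Definition is_frame (R : realType) (E : 'M[R]_3) : Prop :=
  E^T *m D3 R *m E = D3 R /\ \det E = 1.

(* [hodge_star u v w]: v is in the normal plane of the unit tangent u, and w is
   its image under the Hodge star of that plane, the linear map which fixes e_1
   and negates e_2.  By [hodge_star_frame] the frame used is irrelevant. *)
Definition hodge_star (R : realType) (u v w : 'cV[R]_3) : Prop :=
  exists E : 'M[R]_3, exists a b : R,
    [/\ is_frame E, e_ 0 E = u,
        v = a *: e_ 1 E + b *: e_ 2 E &
        w = a *: e_ 1 E - b *: e_ 2 E].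

(* For a frame, D3^-1 *m cross e_0 e_i = +- 2 e_i, i = 1, 2. *)
Definition cross (R : realType) (u v : 'cV[R]_3) : 'cV[R]_3 :=
  let c i := u (inord i) 0 in let d i := v (inord i) 0 in
  \col_i nth 0 [:: c 1%N * d 2%N - c 2%N * d 1%N;
                   c 2%N * d 0%N - c 0%N * d 2%N;
                   c 0%N * d 1%N - c 1%N * d 0%N] i.

Lemma hodge_star_cross (R : realType) (u v w : 'cV[R]_3) :
  hodge_star u v w -> cross u v = 2 *: (D3 R *m w).
Proof.
case=> E [a [b [[EDE detE] <- -> ->]]].
have uE : E^T \in unitmx by rewrite unitmx_tr unitmxE detE unitr1.
apply: (can_inj (mulKmx uE)).
rewrite -scalemxAr !mulmxA mulmxBr -!scalemxAr.
have eE k : E^T *m D3 R *m e_ k E = e_ k (D3 R)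
  by rewrite /e_ !colE mulmxA EDE.
rewrite !eE {EDE eE uE}.
move: detE; rewrite (expand_det_row _ (inord 0)) !big_ord_recl big_ord0.
rewrite /cofactor !(expand_det_row _ 0) !big_ord_recl !big_ord0.
rewrite /cofactor !det_mx11 !mxE /=.
pose c i j := E (inord i) (inord j).
have cE i j : E i j = c i j by rewrite /c !inord_val.
rewrite !cE /= !inordK //= /bump /= !add0n => detE.
apply/matrixP => i j; rewrite {j}(ord1 j) !mxE !big_ord_recl big_ord0 !mxE /=.
rewrite !cE /= !inordK //= /bump /=.
have := congr1 ( *%R a) detE; have := congr1 ( *%R b) detE.
case: i => [[|[|[|//]]] /= ?]; lra.
Qed.

Lemma hodge_star_frame (R : realType) (E : 'M[R]_3) (a b : R) (w : 'cV[R]_3) :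
  is_frame E ->
  hodge_star (e_ 0 E) (a *: e_ 1 E + b *: e_ 2 E) w <->
  w = a *: e_ 1 E - b *: e_ 2 E.
Proof.
move=> frE; split=> [/hodge_star_cross wE | ->]; last by exists E, a, b.
have /hodge_star_cross : hodge_star (e_ 0 E) (a *: e_ 1 E + b *: e_ 2 E)
    (a *: e_ 1 E - b *: e_ 2 E) by exists E, a, b.
rewrite wE => /(scalerI (_ : 2 != 0)); rewrite pnatr_eq0 => /(_ isT).
suff detD : \det (D3 R) = - 4^-1.
  apply: (can_inj (mulKmx _)).
  by rewrite unitmxE unitfE detD oppr_eq0 invr_eq0 pnatr_eq0.
rewrite (expand_det_row _ (inord 0)) !big_ord_recl big_ord0.
rewrite /cofactor !(expand_det_row _ 0) !big_ord_recl !big_ord0.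
rewrite /cofactor !det_mx11 !mxE /= !inordK //= /bump /=.
by field.
Qed.

(* The mean curvature vector of a curve parametrized by arc-length. *)
Definition Hcurv (R : realType) (gam : R -> R -> 'cV[R]_3)
  : R -> R -> 'cV[R]_3 := dx (dx gam).

(* gam_t = - 1/2 * H(gam), for gam smooth, space-like and parametrized by
   arc-length. *)
Definition starMCF (R : realType) (gam : R -> R -> 'cV[R]_3) : Prop :=
  [/\ smooth gam,
      forall x t, lorentz (dx gam x t) (dx gam x t) = 1 &
      forall x t, exists2 w,
        hodge_star (dx gam x t) (Hcurv gam x t) w &
        dt gam x t = - 2^-1 *: w].

Definition adapted_null_pframe (R : realType) (gam : R -> R -> 'cV[R]_3)
    (g : R -> R -> 'M[R]_3) (k1 k2 : R -> R -> R) : Prop :=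
  [/\ smooth g,
      forall x t, is_frame (g x t),
      forall x t, e_ 0 (g x t) = dx gam x t,
      forall x t, invmx (g x t) *m dx g x t =
        mx3 0        (- (k2 x t / 2)) (- (k1 x t / 2))
            (k1 x t) 0                0
            (k2 x t) 0                0 &
      forall x t, invmx (g x t) *m dt g x t =
        4^-1 *: mx3 0                   (- dx k2 x t)     (dx k1 x t)
                    (- (2 * dx k1 x t)) (k1 x t * k2 x t) 0
                    (2 * dx k2 x t)     0                 (- (k1 x t * k2 x t))].

(* Solutions are classical, i.e. of class C^1. *)
Definition lax_solution (R : realType) (q r : R -> R -> R) (alpha : R)
    (xi : R -> R -> 'cV[R]_2) : Prop :=
  [/\ class_C 1 xi,
      forall x t, dx xi x t =
        - (mx2 alpha   (q x t)
               (r x t) (- alpha) *m xi x t) &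
      forall x t, dt xi x t =
        - (mx2 (alpha ^+ 2 - 2^-1 * (q x t * r x t))
               (alpha * q x t - 2^-1 * dx q x t)
               (alpha * r x t + 2^-1 * dx r x t)
               (- alpha ^+ 2 + 2^-1 * (q x t * r x t)) *m xi x t)].

(* Main.v *)
(* In sl(2,R), with a = diag(1,-1), U = [[0, q], [r, 0]] and
   V = 1/2 [[- q r, - q_x], [r_x, q r]], read all vectors in the moving frame g,
   which satisfies g_x = g [U, .] and g_t = g [V, .], while gam_x = a and
   gam_t = U. Put S = Y diag(1/alpha_1, 1/alpha_2) Y^-1: its trace is constant
   and gam' is gam plus its traceless part. The Lax system gives
   S_x = - [a S^-1 + U, S] and S_t = - [a S^-2 + U S^-1 + V, S]; hence, with
   N = U + [a, S^-1] = q' e_12 + r' e_21,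
     gam'_x = S a S^-1,  gam'_xx = S [N, a] S^-1,  gam'_t = S N S^-1.
   So g Ad(S) is a frame along gam' in which H = - 2 q' e_1 + 2 r' e_2 and
   gam'_t = q' e_1 + r' e_2, which is the flow equation. *)

Require Import Defs.
From mathcomp Require Import all_boot all_order all_algebra.
From mathcomp Require Import ring.
From mathcomp Require Import all_classical all_reals all_analysis.

Import Order.TTheory GRing.Theory Num.Theory.
Import numFieldNormedType.Exports.

Local Open Scope classical_set_scope.
Local Open Scope ring_scope.

(** * Calculus of functions of class C^n on the plane, with values in R or in matrices *)

Section ClassC.
Context {R : realType}.
Implicit Types (f h : R -> R -> R).

Lemma funext2 {A B C : Type} {f h : A -> B -> C} :
  (forall x t, f x t = h x t) -> f = h.
Proof. by move=> fh; apply/funext => x; apply/funext => t. Qed.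

Lemma class_CW {V : normedModType R} {n} {f : R -> R -> V} :
  class_C n.+1 f -> class_C n f.
Proof.
elim: n f => [|n IHn] f; first by case.
case=> fc [fx ft /IHn fdx /IHn fdt]; split; first exact: fc.
by split; [exact: fx|exact: ft|exact: fdx|exact: fdt].
Qed.

Lemma class_C_continuous {V : normedModType R} {n} {f : R -> R -> V} :
  class_C n f -> continuous (fun p : R * R => f p.1 p.2).
Proof. by case: n => [|n] []. Qed.

Lemma is_derive_dx {V : normedModType R} {n} {f : R -> R -> V} x t :
  class_C n.+1 f -> is_derive x (1 : R) (fun s => f s t) (dx f x t).
Proof.
by case=> _ [fx _ _ _]; rewrite /dx derive1E; exact: derivableP (fx x t).
Qed.

Lemma is_derive_dt {V : normedModType R} {n} {f : R -> R -> V} x t :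
  class_C n.+1 f -> is_derive t (1 : R) (f x) (dt f x t).
Proof.
by case=> _ [_ ft _ _]; rewrite /dt derive1E; exact: derivableP (ft x t).
Qed.

Lemma dx_val {V : normedModType R} {f : R -> R -> V} {x t a} :
  is_derive x (1 : R) (fun s => f s t) a -> dx f x t = a.
Proof. by move=> fE; rewrite /dx derive1E derive_val. Qed.

Lemma dt_val {V : normedModType R} {f : R -> R -> V} {x t a} :
  is_derive t (1 : R) (f x) a -> dt f x t = a.
Proof. by move=> fE; rewrite /dt derive1E derive_val. Qed.

(** Lets both partial derivatives be supplied as explicit formulas, to which an induction hypothesis
    on n can be applied; extensionality identifies them with [dx f] and [dt f]. *)
Lemma class_CS {V : normedModType R} {n} {f : R -> R -> V}
    (fx ft : R -> R -> V) :
    continuous (fun p : R * R => f p.1 p.2) ->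
    (forall x t, is_derive x (1 : R) (fun s => f s t) (fx x t)) ->
    (forall x t, is_derive t (1 : R) (f x) (ft x t)) ->
    class_C n fx -> class_C n ft ->
  class_C n.+1 f.
Proof.
move=> fc fxE ftE Cfx Cft; split=> //.
have -> : dx f = fx by apply: funext2 => x t; exact: dx_val.
have -> : dt f = ft by apply: funext2 => x t; exact: dt_val.
by split.
Qed.

Lemma class_C_cst (V : normedModType R) n (a : V) : class_C n (fun _ _ => a).
Proof.
elim: n a => [|n IHn] a; first by split=> [p|]; [exact: cvg_cst|exact: I].
apply: (class_CS (fun _ _ => 0) (fun _ _ => 0)).
- by move=> p; exact: cvg_cst.
- by move=> x t; exact: is_derive_cst.
- exact: IHn.
- exact: IHn.
Qed.

Lemma class_CD {n f h} :
  class_C n f -> class_C n h -> class_C n (fun x t => f x t + h x t).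
Proof.
elim: n f h => [|n IHn] f h Cf Ch.
  split=> // p; apply: cvgD; [exact: (class_C_continuous Cf p)|].
  exact: (class_C_continuous Ch p).
apply: (class_CS (fun x t => dx f x t + dx h x t)
  (fun x t => dt f x t + dt h x t)) => [p|x t|x t||].
- apply: cvgD; [exact: (class_C_continuous Cf p)|].
  exact: (class_C_continuous Ch p).
- apply: is_deriveD; first exact: (is_derive_dx _ _ Cf).
  exact: (is_derive_dx _ _ Ch).
- apply: is_deriveD; first exact: (is_derive_dt _ _ Cf).
  exact: (is_derive_dt _ _ Ch).
- by case: Cf Ch => _ [_ _ ? _] [_ [_ _ ? _]]; exact: IHn.
- by case: Cf Ch => _ [_ _ _ ?] [_ [_ _ _ ?]]; exact: IHn.
Qed.

Lemma class_CM {n f h} :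
  class_C n f -> class_C n h -> class_C n (fun x t => f x t * h x t).
Proof.
elim: n f h => [|n IHn] f h Cf Ch.
  split=> // p; apply: cvgM; [exact: (class_C_continuous Cf p)|].
  exact: (class_C_continuous Ch p).
apply: (class_CS (fun x t => f x t * dx h x t + h x t * dx f x t)
  (fun x t => f x t * dt h x t + h x t * dt f x t)) => [p|x t|x t||].
- apply: cvgM; [exact: (class_C_continuous Cf p)|].
  exact: (class_C_continuous Ch p).
- apply: is_deriveM; first exact: (is_derive_dx _ _ Cf).
  exact: (is_derive_dx _ _ Ch).
- apply: is_deriveM; first exact: (is_derive_dt _ _ Cf).
  exact: (is_derive_dt _ _ Ch).
(* The Leibniz rule also involves f and h themselves, which are used one class lower. *)
- have [Cf' Ch'] := (class_CW Cf, class_CW Ch).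
  by case: Cf Ch => _ [_ _ ? _] [_ [_ _ ? _]]; apply: class_CD; exact: IHn.
- have [Cf' Ch'] := (class_CW Cf, class_CW Ch).
  by case: Cf Ch => _ [_ _ _ ?] [_ [_ _ _ ?]]; apply: class_CD; exact: IHn.
Qed.

Lemma class_CN {n f} : class_C n f -> class_C n (fun x t => - f x t).
Proof.
move=> Cf; rewrite (_ : (fun _ _ => _) = fun x t => -1 * f x t).
  by apply: class_CM => //; exact: class_C_cst.
by apply: funext2 => x t; rewrite mulN1r.
Qed.

Lemma is_derive1V {f : R -> R} {x a} :
  f x != 0 -> is_derive x (1 : R) f a ->
  is_derive x (1 : R) (fun s => (f s)^-1) (- (f x) ^- 2 * a).
Proof.
move=> f0 fE; apply: DeriveDef; first by apply: derivableV => //; case: fE.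
by rewrite deriveV ?derive_val//; case: fE.
Qed.

(** Both partial derivatives have the form -(1/f)^2 f'. The induction hypothesis handles 1/f one
    class lower, and stability under products does the rest. *)
Lemma class_CV {n f} :
  (forall x t, f x t != 0) -> class_C n f -> class_C n (fun x t => (f x t)^-1).
Proof.
move=> f0; have CfV m : class_C m f ->
    continuous (fun p : R * R => (f p.1 p.2)^-1).
  by move=> Cf p; apply: cvgV => //; exact: (class_C_continuous Cf p).
elim: n => [|n IHn] Cf; first by split => //; exact: CfV Cf.
have CV := IHn (class_CW Cf).
apply: (class_CS (fun x t => - ((f x t)^-1 * (f x t)^-1) * dx f x t)
  (fun x t => - ((f x t)^-1 * (f x t)^-1) * dt f x t)) => [|x t|x t||].
- exact: CfV Cf.
- by rewrite -invfM; apply: is_derive1V => //; exact: (is_derive_dx _ _ Cf).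
- by rewrite -invfM; apply: is_derive1V => //; exact: (is_derive_dt _ _ Cf).
- by case: Cf => _ [_ _ ? _]; apply: class_CM => //; apply/class_CN/class_CM.
- by case: Cf => _ [_ _ _ ?]; apply: class_CM => //; apply/class_CN/class_CM.
Qed.

Lemma is_derive_mxP {m n} {F : R -> 'M[R]_(m, n)} {x} {A : 'M[R]_(m, n)} :
  is_derive x (1 : R) F A <->
  forall i j, is_derive x (1 : R) (fun s => F s i j) (A i j).
Proof.
split=> [FA i j|FA].
  have dF : derivable F x 1 by case: FA.
  apply: DeriveDef; first by apply/derivable_mxP : i j.
  by have := derive_mx dF; rewrite derive_val => ->; rewrite mxE.
have dF : derivable F x 1 by apply/derivable_mxP => i j; case: (FA i j).
apply: DeriveDef => //; rewrite derive_mx//.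
by apply/matrixP => i j; rewrite mxE derive_val.
Qed.

Lemma continuous_mxP {T : topologicalType} {m n} {F : T -> 'M[R]_(m, n)} :
  continuous F <-> forall i j, continuous (fun p => F p i j).
Proof.
split=> [Fc i j p|Fc p].
  exact: (continuous_comp (Fc p) (@coord_continuous _ _ _ i j (F p))).
(* There are finitely many entries, so the neighbourhoods obtained for each of them can be
   intersected. *)
apply/cvg_mx_entourageP => A entA.
apply: filter_forall => i; apply: filter_forall => j.
near=> N do rewrite inE.
by have /cvg_entourageP := Fc i j p; exact.
Unshelve. all: by end_near. Qed.

(** Reduces every later smoothness question about curves and frames to scalar entries. *)
Lemma class_C_mxP {m n k} {F : R -> R -> 'M[R]_(m, n)} :
  class_C k F <-> forall i j, class_C k (fun x t => F x t i j).
Proof.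
elim: k F => [|k IHk] F.
  split=> [[/continuous_mxP Fc _] i j|FC]; first by split=> //; exact: Fc.
  by split=> //; apply/continuous_mxP => i j; case: (FC i j).
split=> [CF i j|CF].
  apply: (class_CS (fun x t => dx F x t i j) (fun x t => dt F x t i j)).
  - by have /continuous_mxP := class_C_continuous CF; exact.
  - by move=> x t; apply/is_derive_mxP : i j; exact: is_derive_dx CF.
  - by move=> x t; apply/is_derive_mxP : i j; exact: is_derive_dt CF.
  - by case: CF => _ [_ _ /IHk + _]; exact.
  - by case: CF => _ [_ _ _ /IHk +]; exact.
apply: (class_CS (fun x t => \matrix_(i, j) dx (fun x t => F x t i j) x t)
  (fun x t => \matrix_(i, j) dt (fun x t => F x t i j) x t)).
- by apply/continuous_mxP => i j; exact: class_C_continuous (CF i j).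
- move=> x t; apply/is_derive_mxP => i j; rewrite mxE.
  exact: (is_derive_dx _ _ (CF i j)).
- move=> x t; apply/is_derive_mxP => i j; rewrite mxE.
  exact: (is_derive_dt _ _ (CF i j)).
- apply/IHk => i j; under eq_fun do under eq_fun do rewrite mxE.
  by case: (CF i j) => _ [].
- apply/IHk => i j; under eq_fun do under eq_fun do rewrite mxE.
  by case: (CF i j) => _ [].
Qed.

Lemma class_C_mulmx {m n p k} {F : R -> R -> 'M[R]_(m, n)}
    {G : R -> R -> 'M[R]_(n, p)} :
  class_C k F -> class_C k G -> class_C k (fun x t => F x t *m G x t).
Proof.
move=> /class_C_mxP CF /class_C_mxP CG; apply/class_C_mxP => i j.
under eq_fun do under eq_fun do rewrite mxE.
(* Induction on the list of summation indices turns an entry of the product into a finite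
   combination of sums and products. *)
elim: (index_enum _) => [|l s IHs].
  by under eq_fun do under eq_fun do rewrite big_nil; exact: class_C_cst.
under eq_fun do under eq_fun do rewrite big_cons.
by apply: class_CD => //; exact: class_CM.
Qed.

Lemma smooth_dx {V : normedModType R} {f : R -> R -> V} :
  smooth f -> smooth (dx f).
Proof. by move=> fs n; case: (fs n.+1) => _ []. Qed.

End ClassC.

(** * Matrices of size three, frames, and the adjoint action on sl(2,R) *)

Lemma ord3_ind (P : 'I_3 -> Prop) :
  P (inord 0) -> P (inord 1) -> P (inord 2) -> forall i, P i.
Proof.
move=> P0 P1 P2 i; rewrite -(inord_val i).
by case: i => [[|[|[|]]]].
Qed.

Lemma sum_ord3 (V : zmodType) (F : 'I_3 -> V) :
  \sum_i F i = F (inord 0) + F (inord 1) + F (inord 2).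
Proof.
rewrite !big_ord_recl big_ord0 addr0 addrA.
by congr (F _ + F _ + F _); apply/val_inj; rewrite /= inordK.
Qed.

Section Matrices.
Context {R : realType}.

Lemma mx3E (a b c d e f g h k : R) (i j : nat) :
  (i < 3)%N -> (j < 3)%N -> mx3 a b c d e f g h k (inord i) (inord j) =
  nth 0 (nth [::] [:: [:: a; b; c]; [:: d; e; f]; [:: g; h; k]] i) j.
Proof. by move=> i3 j3; rewrite mxE !inordK. Qed.

Lemma det_mx3 (a b c d e f g h k : R) :
  \det (mx3 a b c d e f g h k) =
  a * (e * k - f * h) - b * (d * k - f * g) + c * (d * h - e * g).
Proof.
rewrite (expand_det_row _ 0) !big_ord_recl big_ord0.
rewrite /cofactor !(expand_det_row _ 0) !big_ord_recl !big_ord0.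
by rewrite /cofactor !det_mx11 !mxE /=; ring.
Qed.

Lemma det_mx2 (a b c d : R) : \det (mx2 a b c d) = a * d - b * c.
Proof.
rewrite (expand_det_row _ 0) !big_ord_recl big_ord0.
by rewrite /cofactor !det_mx11 !mxE /=; ring.
Qed.

Lemma mulmx_mx3 (g : 'M[R]_3) (a b c d e f u v w : R) (i : 'I_3) (j : nat) :
  (j < 3)%N -> (g *m mx3 a b c d e f u v w) i (inord j) =
  g i (inord 0) * nth 0 [:: a; b; c] j + g i (inord 1) * nth 0 [:: d; e; f] j
  + g i (inord 2) * nth 0 [:: u; v; w] j.
Proof. by move=> j3; rewrite mxE sum_ord3 !mx3E. Qed.

Lemma is_frame_mul (E F : 'M[R]_3) : is_frame E -> is_frame F ->
  is_frame (E *m F).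
Proof.
move=> [EDE detE] [FDF detF]; split; last by rewrite det_mulmx detE detF mulr1.
have -> : (E *m F)^T *m D3 R *m (E *m F) = F^T *m (E^T *m D3 R *m E) *m F.
  by rewrite trmx_mul !mulmxA.
by rewrite EDE.
Qed.

Lemma is_frame_unit (E : 'M[R]_3) : is_frame E -> E \in unitmx.
Proof. by case=> _ detE; rewrite unitmxE detE unitr1. Qed.

(** The product of the first column with itself is the top left entry of E^T D3 E = D3. *)
Lemma lorentz_frame0 (E : 'M[R]_3) :
  is_frame E -> lorentz (e_ 0 E) (e_ 0 E) = 1.
Proof.
case=> EDE _; rewrite /lorentz /e_ colE trmx_mul.
have -> (u : 'cV_3) : u^T *m E^T *m D3 R *m (E *m u) =
    u^T *m (E^T *m D3 R *m E) *m u by rewrite !mulmxA.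
by rewrite EDE trmx_delta -rowE -colE !mxE inordK.
Qed.

(* Conjugation by the matrix [[a, b], [c, d]], in the basis diag(1,-1), e_12,
   e_21 of sl(2). *)
Definition Ad2 (a b c d : R) : 'M[R]_3 :=
  let D := a * d - b * c in
  mx3 ((a * d + b * c) / D) (- (a * c) / D) (b * d / D)
      (- (2 * a * b) / D)   (a ^+ 2 / D)    (- b ^+ 2 / D)
      (2 * c * d / D)       (- c ^+ 2 / D)  (d ^+ 2 / D).

(** Conjugation preserves the trace form, whose Gram matrix in this basis is [D3]. The proof
    verifies the resulting rational identities entry by entry. *)
Lemma is_frame_Ad2 (a b c d : R) : a * d - b * c != 0 ->
  is_frame (Ad2 a b c d).
Proof.
move=> D0; split; last by rewrite det_mx3; field.
apply/matrixP; apply: ord3_ind; apply: ord3_ind;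
  rewrite !mxE !sum_ord3 !mxE !sum_ord3 !mxE !inordK//=; field => //.
Qed.

End Matrices.

(** * Differentiation of rational expressions in one variable *)

Section ScalarDerivative.
Context {R : realType}.
Implicit Types (f h : R -> R) (x a b : R).

Lemma is_derive1D {f h x a b} : is_derive x (1 : R) f a ->
  is_derive x (1 : R) h b -> is_derive x (1 : R) (fun s => f s + h s) (a + b).
Proof. exact: is_deriveD. Qed.

Lemma is_derive1N {f x a} : is_derive x (1 : R) f a ->
  is_derive x (1 : R) (fun s => - f s) (- a).
Proof. exact: is_deriveN. Qed.

Lemma is_derive1M {f h x a b} : is_derive x (1 : R) f a ->
  is_derive x (1 : R) h b ->
  is_derive x (1 : R) (fun s => f s * h s) (f x * b + h x * a).
Proof. exact: is_deriveM. Qed.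

Lemma is_derive1c {x a} : is_derive x (1 : R) (fun=> a) 0.
Proof. exact: is_derive_cst. Qed.

(** Separates the computation of a derivative from the algebraic identity that brings its value to
    the desired form. *)
Lemma is_derive1_eq {f x a b} : is_derive x (1 : R) f a -> a = b ->
  is_derive x (1 : R) f b.
Proof. by move=> ? <-. Qed.

End ScalarDerivative.

(** The value of the derivative may be an existential variable, which the rules fill in as they
    match the expression. Hypotheses supply the derivatives of the base functions; nonvanishing of
    denominators arises as a side condition. *)
Ltac derive_rules :=
  repeat first [ eassumption | exact: is_derive1c
    | eapply is_derive1D | eapply is_derive1N | eapply is_derive1M
    | eapply is_derive1V ].

(** * Coordinates of a frame composed with a conjugation *)

Section Ad2Columns.
Context {R : realType} (a b c d : R).

(** G0, G1, G2 stand for one row of the frame, so that vector identities become scalar ones, one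
    coordinate at a time. Products replace squares because [derive_rules] has no rule for powers. *)
Definition Ad2_0 (G0 G1 G2 : R) :=
  ((a * d + b * c) * G0 - 2 * (a * b) * G1 + 2 * (c * d) * G2)
  / (a * d - b * c).
Definition Ad2_1 (G0 G1 G2 : R) :=
  (a * a * G1 - a * c * G0 - c * c * G2) / (a * d - b * c).
Definition Ad2_2 (G0 G1 G2 : R) :=
  (b * d * G0 - b * b * G1 + d * d * G2) / (a * d - b * c).

Lemma mulmx_Ad2 (g : 'M[R]_3) (i : 'I_3) :
  let G j := g i (inord j) in
  [/\ (g *m Ad2 a b c d) i (inord 0) = Ad2_0 (G 0%N) (G 1%N) (G 2%N),
      (g *m Ad2 a b c d) i (inord 1) = Ad2_1 (G 0%N) (G 1%N) (G 2%N) &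
      (g *m Ad2 a b c d) i (inord 2) = Ad2_2 (G 0%N) (G 1%N) (G 2%N)].
Proof.
rewrite /Ad2 !mulmx_mx3//=; split;
  by rewrite /Ad2_0 /Ad2_1 /Ad2_2; ring.
Qed.

End Ad2Columns.

(** * The Darboux matrix S and the derivatives of the transformed curve *)

Section Darboux.
Context {R : realType} (a1 a2 : R).

(* The entries of a1 a2 det(Y) S, where S = Y diag(1/a1, 1/a2) Y^-1. *)
Definition darboux11 (y1 y2 y3 y4 : R) := a2 * (y1 * y4) - a1 * (y2 * y3).
Definition darboux12 (y1 y3 : R) := (a1 - a2) * (y1 * y3).
Definition darboux21 (y2 y4 : R) := (a2 - a1) * (y2 * y4).
Definition darboux22 (y1 y2 y3 y4 : R) := a1 * (y1 * y4) - a2 * (y2 * y3).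

(** [Ad2] is homogeneous of degree 0 in its four arguments, so the multiple a1 a2 det(Y) S,
    polynomial in the y's, gives the same conjugation as S. *)
Definition darboux_Ad y1 y2 y3 y4 :=
  Ad2 (darboux11 y1 y2 y3 y4) (darboux12 y1 y3)
      (darboux21 y2 y4) (darboux22 y1 y2 y3 y4).

Definition dressed_e0 y1 y2 y3 y4 :=
  Ad2_0 (darboux11 y1 y2 y3 y4) (darboux12 y1 y3)
        (darboux21 y2 y4) (darboux22 y1 y2 y3 y4).
Definition dressed_e1 y1 y2 y3 y4 :=
  Ad2_1 (darboux11 y1 y2 y3 y4) (darboux12 y1 y3)
        (darboux21 y2 y4) (darboux22 y1 y2 y3 y4).
Definition dressed_e2 y1 y2 y3 y4 :=
  Ad2_2 (darboux11 y1 y2 y3 y4) (darboux12 y1 y3)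
        (darboux21 y2 y4) (darboux22 y1 y2 y3 y4).

(* U + [a, S^-1] = dressed_q e_12 + dressed_r e_21. *)
Definition dressed_q (q y1 y2 y3 y4 : R) :=
  q + 2 * (a2 - a1) * (y1 * y3) / (y1 * y4 - y3 * y2).
Definition dressed_r (r y1 y2 y3 y4 : R) :=
  r + 2 * (a2 - a1) * (y2 * y4) / (y1 * y4 - y3 * y2).

(** One coordinate of gam'. The term added to gm is the traceless part of S read in the frame; its
    factor comes from (a2 - a1) / (a1 a2) = 1/a1 - 1/a2. *)
Definition dressed_curve (gm G0 G1 G2 y1 y2 y3 y4 : R) :=
  gm + ((a1^-1 - a2^-1) * (y1 * y4 - y3 * y2)^-1) *
    (((y1 * y4 + y2 * y3) / 2) * G0 - (y1 * y3) * G1 + (y2 * y4) * G2).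

(** Since det S = 1/(a1 a2), scaling S by a1 a2 det(Y) multiplies this determinant by the square of
    the factor. The closed form shows that it vanishes only with a1, a2 or det(Y). *)
Lemma darboux_det y1 y2 y3 y4 :
  darboux11 y1 y2 y3 y4 * darboux22 y1 y2 y3 y4
    - darboux12 y1 y3 * darboux21 y2 y4 =
  a1 * a2 * (y1 * y4 - y3 * y2) ^+ 2.
Proof. by rewrite /darboux11 /darboux12 /darboux21 /darboux22; ring. Qed.

Context (a1_neq0 : a1 != 0) (a2_neq0 : a2 != 0).

Lemma is_frame_darboux_Ad y1 y2 y3 y4 :
  y1 * y4 - y3 * y2 != 0 -> is_frame (darboux_Ad y1 y2 y3 y4).
Proof. by move=> D0; apply: is_frame_Ad2; rewrite darboux_det !mulf_neq0. Qed.

Section SpaceDerivatives.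
Context (gm G0 G1 G2 y1 y2 y3 y4 : R -> R) (q r x : R).
Context (dG0 : is_derive x (1 : R) G0 (- (2 * q) * G1 x + 2 * r * G2 x))
  (dG1 : is_derive x (1 : R) G1 (- r * G0 x))
  (dG2 : is_derive x (1 : R) G2 (q * G0 x))
  (dgm : is_derive x (1 : R) gm (G0 x))
  (dy1 : is_derive x (1 : R) y1 (- (a1 * y1 x + q * y2 x)))
  (dy2 : is_derive x (1 : R) y2 (- (r * y1 x - a1 * y2 x)))
  (dy3 : is_derive x (1 : R) y3 (- (a2 * y3 x + q * y4 x)))
  (dy4 : is_derive x (1 : R) y4 (- (r * y3 x - a2 * y4 x)))
  (D0 : y1 x * y4 x - y3 x * y2 x != 0).

(** One coordinate of gam'_x = S a S^-1. The differential equations enter only through their values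
    at x, which leaves a rational identity for [field]. *)
Lemma is_derive_darboux_x : is_derive x (1 : R)
   (fun s => dressed_curve (gm s) (G0 s) (G1 s) (G2 s)
      (y1 s) (y2 s) (y3 s) (y4 s))
   (dressed_e0 (y1 x) (y2 x) (y3 x) (y4 x) (G0 x) (G1 x) (G2 x)).
Proof.
eapply is_derive1_eq.
  rewrite /dressed_curve; derive_rules; exact: D0.
rewrite /dressed_e0 /Ad2_0 darboux_det.
rewrite /darboux11 /darboux12 /darboux21 /darboux22 /=.
field.
by rewrite a1_neq0 a2_neq0 D0.
Qed.

(** One coordinate of gam'_xx = S [N, a] S^-1, where [e_12, a] = - 2 e_12 and [e_21, a] = 2 e_21
    produce the two coefficients. *)
Lemma is_derive_darboux_xx : is_derive x (1 : R)
   (fun s => dressed_e0 (y1 s) (y2 s) (y3 s) (y4 s) (G0 s) (G1 s) (G2 s))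
   (- 2 * dressed_q q (y1 x) (y2 x) (y3 x) (y4 x) *
     dressed_e1 (y1 x) (y2 x) (y3 x) (y4 x) (G0 x) (G1 x) (G2 x)
   + 2 * dressed_r r (y1 x) (y2 x) (y3 x) (y4 x) *
     dressed_e2 (y1 x) (y2 x) (y3 x) (y4 x) (G0 x) (G1 x) (G2 x)).
Proof.
eapply is_derive1_eq.
  (* The determinant takes its closed form before differentiation, so that the denominator is
     visibly nonzero; its square is then unfolded into a product. *)
  rewrite /dressed_e0 /Ad2_0; under eq_fun do rewrite darboux_det.
  rewrite /darboux11 /darboux12 /darboux21 /darboux22.
  under eq_fun do rewrite expr2.
  derive_rules; rewrite !mulf_eq0 !negb_or D0 a1_neq0 a2_neq0//.
rewrite /dressed_e1 /dressed_e2 /Ad2_1 /Ad2_2 darboux_det.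
rewrite /darboux11 /darboux12 /darboux21 /darboux22 /dressed_q /dressed_r /=.
field.
by rewrite a1_neq0 a2_neq0 D0.
Qed.
End SpaceDerivatives.

Section TimeDerivative.
Context (gm G0 G1 G2 y1 y2 y3 y4 : R -> R) (q r qx rx t : R).
Context (dG0 : is_derive t (1 : R) G0 (qx * G1 t + rx * G2 t))
  (dG1 : is_derive t (1 : R) G1 (- (rx / 2) * G0 t - q * r * G1 t))
  (dG2 : is_derive t (1 : R) G2 (- (qx / 2) * G0 t + q * r * G2 t))
  (dgm : is_derive t (1 : R) gm (q * G1 t + r * G2 t))
  (dy1 : is_derive t (1 : R) y1
    (- ((a1 ^+ 2 - 2^-1 * (q * r)) * y1 t + (a1 * q - 2^-1 * qx) * y2 t)))
  (dy2 : is_derive t (1 : R) y2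
    (- ((a1 * r + 2^-1 * rx) * y1 t + (- a1 ^+ 2 + 2^-1 * (q * r)) * y2 t)))
  (dy3 : is_derive t (1 : R) y3
    (- ((a2 ^+ 2 - 2^-1 * (q * r)) * y3 t + (a2 * q - 2^-1 * qx) * y4 t)))
  (dy4 : is_derive t (1 : R) y4
    (- ((a2 * r + 2^-1 * rx) * y3 t + (- a2 ^+ 2 + 2^-1 * (q * r)) * y4 t)))
  (D0 : y1 t * y4 t - y3 t * y2 t != 0).

(** One coordinate of gam'_t = S N S^-1. The terms in qx and rx coming from the frame cancel those
    coming from the Lax system. *)
Lemma is_derive_darboux_t : is_derive t (1 : R)
   (fun s => dressed_curve (gm s) (G0 s) (G1 s) (G2 s)
      (y1 s) (y2 s) (y3 s) (y4 s))
   (dressed_q q (y1 t) (y2 t) (y3 t) (y4 t) *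
     dressed_e1 (y1 t) (y2 t) (y3 t) (y4 t) (G0 t) (G1 t) (G2 t)
   + dressed_r r (y1 t) (y2 t) (y3 t) (y4 t) *
     dressed_e2 (y1 t) (y2 t) (y3 t) (y4 t) (G0 t) (G1 t) (G2 t)).
Proof.
eapply is_derive1_eq.
  rewrite /dressed_curve; derive_rules; exact: D0.
rewrite /dressed_e1 /dressed_e2 /Ad2_1 /Ad2_2 darboux_det.
rewrite /darboux11 /darboux12 /darboux21 /darboux22 /dressed_q /dressed_r /=.
field.
by rewrite a1_neq0 a2_neq0 D0.
Qed.
End TimeDerivative.
End Darboux.

(** * Solutions of the Lax system: smoothness, independence, coordinates *)

Section Smoothness.
Context {R : realType}.

Lemma class_C_trmx {m n k} {F : R -> R -> 'M[R]_(m, n)} :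
  class_C k F -> class_C k (fun x t => (F x t)^T).
Proof.
move=> /class_C_mxP CF; apply/class_C_mxP => i j.
by under eq_fun do under eq_fun do rewrite mxE.
Qed.

Lemma class_C_mx2N {k} {a b c d : R -> R -> R} :
  class_C k a -> class_C k b -> class_C k c -> class_C k d ->
  class_C k (fun x t => - mx2 (a x t) (b x t) (c x t) (d x t)).
Proof.
move=> Ca Cb Cc Cd; apply/class_C_mxP => i j.
under eq_fun do under eq_fun do rewrite !mxE.
by apply: class_CN; case: i j => [[|[|//]] ?] [[|[|//]] ?].
Qed.

(** Bootstrapping: the system writes both partial derivatives as smooth matrices times xi, so class
    C^n of xi passes to them and xi is of class C^(n+1). The induction starts at n = 1, where the
    partial derivatives exist by assumption. *)
Lemma lax_solution_smooth {q r : R -> R -> R} {alpha}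
    {xi : R -> R -> 'cV[R]_2} :
  smooth q -> smooth r -> lax_solution q r alpha xi -> smooth xi.
Proof.
move=> Sq Sr [C1 xix xit]; case=> [|n]; first exact: class_CW C1.
elim: n => // n IHn.
have C1' : class_C 1 xi by [].
apply: (class_CS (dx xi) (dt xi)) => [|x t|x t||].
- exact: class_C_continuous C1.
- exact: is_derive_dx C1.
- exact: is_derive_dt C1.
- rewrite (_ : dx xi = fun x t => - mx2 alpha (q x t) (r x t) (- alpha)
      *m xi x t); last first.
    by apply: funext2 => x t; rewrite xix mulNmx.
  by apply: class_C_mulmx => //; apply: class_C_mx2N => //; exact: class_C_cst.
- rewrite (_ : dt xi = fun x t => - mx2 (alpha ^+ 2 - 2^-1 * (q x t * r x t))
      (alpha * q x t - 2^-1 * dx q x t) (alpha * r x t + 2^-1 * dx r x t)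
      (- alpha ^+ 2 + 2^-1 * (q x t * r x t)) *m xi x t); last first.
    by apply: funext2 => x t; rewrite xit mulNmx.
  have Sqx := smooth_dx Sq; have Srx := smooth_dx Sr.
  apply: class_C_mulmx => //; apply: class_C_mx2N;
    do ?[exact: class_C_cst|exact: (Sq _)|exact: (Sr _)|exact: (Sqx _)
        |exact: (Srx _)|apply: class_CD|apply: class_CN|apply: class_CM].
Qed.

End Smoothness.

(** By contraposition: if the determinant vanishes, u is a multiple of v, the factor being the
    quotient of their entries at a nonzero coordinate of v. *)
Lemma free_det2 {R : realType} {u v : 'cV[R]_2} :
  free [:: u; v] -> u 0 0 * v 1 0 - v 0 0 * u 1 0 != 0.
Proof.
rewrite free_cons seq1_free span_seq1 => /andP[uv v0].
apply: contra uv; rewrite subr_eq0 => /eqP det0; apply/vlineP.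
have colE (a b : 'cV[R]_2) : a 0 0 = b 0 0 -> a 1 0 = b 1 0 -> a = b.
  move=> ab0 ab1; apply/colP; case=> [[|[|//]] lti].
    by rewrite (_ : Ordinal lti = 0)//; exact: val_inj.
  by rewrite (_ : Ordinal lti = 1)//; exact: val_inj.
have [v00|v00] := eqVneq (v 0 0) 0; last first.
  exists (u 0 0 / v 0 0); apply: colE; rewrite mxE; first by rewrite divfK.
  by rewrite mulrAC det0 mulrAC mulfV// mul1r.
have v10 : v 1 0 != 0.
  by apply: contra_neq v0 => v10; apply: colE; rewrite mxE.
have u00 : u 0 0 = 0.
  by apply: (mulIf v10); rewrite det0 v00 !mul0r.
by exists (u 1 0 / v 1 0); apply: colE; rewrite mxE ?divfK// u00 v00 mulr0.
Qed.

(** A pair of equations, so that a single [rewrite] serves either coordinate. *)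
Lemma mulmx_mx2 {R : realType} (a b c d : R) (v : 'cV[R]_2) :
  ((mx2 a b c d *m v) 0 0 = a * v 0 0 + b * v 1 0) *
  ((mx2 a b c d *m v) 1 0 = c * v 0 0 + d * v 1 0).
Proof.
by split; rewrite mxE !big_ord_recl big_ord0 addr0 !mxE /=;
  rewrite (_ : lift ord0 ord0 = 1)//; exact: val_inj.
Qed.

Section LaxDerivatives.
Context {R : realType} {q r : R -> R -> R} {alpha : R}.
Context {xi : R -> R -> 'cV[R]_2} (xi_sol : lax_solution q r alpha xi).

Lemma lax_solution_dx x t :
  is_derive x (1 : R) (fun s => xi s t 0 0)
    (- (alpha * xi x t 0 0 + q x t * xi x t 1 0)) /\
  is_derive x (1 : R) (fun s => xi s t 1 0)
    (- (r x t * xi x t 0 0 - alpha * xi x t 1 0)).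
Proof.
have [C1 xix _] := xi_sol.
have := is_derive_dx x t C1; rewrite xix => /is_derive_mxP dxi.
split; apply: (is_derive1_eq (dxi _ _)); rewrite [LHS]mxE mulmx_mx2//.
by rewrite mulNr.
Qed.

Lemma lax_solution_dt x t (q_x := dx q x t) (r_x := dx r x t) :
  is_derive t (1 : R) (fun s => xi x s 0 0)
    (- ((alpha ^+ 2 - 2^-1 * (q x t * r x t)) * xi x t 0 0
        + (alpha * q x t - 2^-1 * q_x) * xi x t 1 0)) /\
  is_derive t (1 : R) (fun s => xi x s 1 0)
    (- ((alpha * r x t + 2^-1 * r_x) * xi x t 0 0
        + (- alpha ^+ 2 + 2^-1 * (q x t * r x t)) * xi x t 1 0)).
Proof.
have [C1 _ xit] := xi_sol.
have := is_derive_dt x t C1; rewrite xit => /is_derive_mxP dxi.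
by split; apply: (is_derive1_eq (dxi _ _)); rewrite [LHS]mxE mulmx_mx2.
Qed.

End LaxDerivatives.

(** * Consequences of the equations of the null frame *)

Section Frame.
Context {R : realType} {gam : R -> R -> 'cV[R]_3} {g : R -> R -> 'M[R]_3}.
Context {k1 k2 : R -> R -> R} (g_frame : adapted_null_pframe gam g k1 k2).

Lemma pframe_dx i x t (G := fun j : nat => g x t i (inord j)) :
  [/\ dx g x t i (inord 0) = k1 x t * G 1%N + k2 x t * G 2%N,
      dx g x t i (inord 1) = - (k2 x t / 2) * G 0%N &
      dx g x t i (inord 2) = - (k1 x t / 2) * G 0%N].
Proof.
have [_ frg _ gx _] := g_frame.
have -> : dx g x t = g x t *m (invmx (g x t) *m dx g x t).
  by rewrite mulKVmx// is_frame_unit.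
by rewrite gx !mulmx_mx3//=; split; rewrite /G; ring.
Qed.

Lemma pframe_dt i x t (G := fun j : nat => g x t i (inord j)) :
  [/\ dt g x t i (inord 0) =
        - (dx k1 x t / 2) * G 1%N + dx k2 x t / 2 * G 2%N,
      dt g x t i (inord 1) =
        - (dx k2 x t / 4) * G 0%N + k1 x t * k2 x t / 4 * G 1%N &
      dt g x t i (inord 2) =
        dx k1 x t / 4 * G 0%N - k1 x t * k2 x t / 4 * G 2%N].
Proof.
have [_ frg _ _ gt] := g_frame.
have -> : dt g x t = g x t *m (invmx (g x t) *m dt g x t).
  by rewrite mulKVmx// is_frame_unit.
have scE (A : 'M[R]_3) a j : (a *: A) i j = a * A i j by rewrite mxE.
by rewrite gt -scalemxAr !scE !mulmx_mx3//=; split; rewrite /G; field.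
Qed.

(* D3 (g^-1 g_x) = g^T D3 g_x makes the curvatures polynomial in the entries of
   g and g_x, with no inverse of g to differentiate. *)
Lemma pframe_curvatures x t (P := (g x t)^T *m D3 R *m dx g x t) :
  k1 x t = 2 * P (inord 2) (inord 0) /\ k2 x t = 2 * P (inord 1) (inord 0).
Proof.
have [_ frg _ gx _] := g_frame; have [gDg _] := frg x t.
have -> : P = D3 R *m (invmx (g x t) *m dx g x t).
  by rewrite -gDg -mulmxA mulKVmx// is_frame_unit.
by rewrite gx !mulmx_mx3// /D3 !mx3E//=; split; field.
Qed.

(** The curvatures inherit smoothness from g through their polynomial expressions in the entries of
    g and g_x. *)
Lemma pframe_smooth : smooth k1 /\ smooth k2.
Proof.
have [Sg _ _ _ _] := g_frame.
have CP n : class_C n (fun x t => (g x t)^T *m D3 R *m dx g x t).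
  apply: class_C_mulmx; last exact: (smooth_dx Sg).
  by apply: class_C_mulmx; [exact: class_C_trmx|exact: class_C_cst].
have CPij n i j := (class_C_mxP.1 (CP n)) i j.
split=> n.
  rewrite (_ : k1 = fun x t => 2 *
      ((g x t)^T *m D3 R *m dx g x t) (inord 2) (inord 0)).
    by apply: class_CM => //; exact: class_C_cst.
  by apply: funext2 => x t; case: (pframe_curvatures x t).
rewrite (_ : k2 = fun x t => 2 *
    ((g x t)^T *m D3 R *m dx g x t) (inord 1) (inord 0)).
  by apply: class_CM => //; exact: class_C_cst.
by apply: funext2 => x t; case: (pframe_curvatures x t).
Qed.

(** The first column of g_x gives H = k1 e_1 + k2 e_2. The flow equation provides the Hodge star in
    some frame; [hodge_star_frame] evaluates it in g. *)
Lemma pframe_starMCF : starMCF gam -> forall x t,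
  dt gam x t = - 2^-1 *: (k1 x t *: e_ 1 (g x t) - k2 x t *: e_ 2 (g x t)).
Proof.
move=> [_ _ gam_t] x t; have [w wE ->] := gam_t x t; congr (_ *: _).
have [Sg frg e0 _ _] := g_frame; move: wE.
have -> : Hcurv gam x t = k1 x t *: e_ 1 (g x t) + k2 x t *: e_ 2 (g x t).
  rewrite /Hcurv (_ : dx gam = fun x t => e_ 0 (g x t)); last first.
    by apply: funext2 => y s; rewrite e0.
  apply: dx_val; apply/is_derive_mxP => i j; rewrite /e_ !mxE.
  under eq_fun do rewrite mxE.
  have [<- _ _] := pframe_dx i x t.
  have := is_derive_dx x t (Sg 1%N).
  by move/is_derive_mxP; exact.
by rewrite -e0 => /(hodge_star_frame _ _ _ (frg x t)).
Qed.

End Frame.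

(** * The transformed curve solves the flow *)

Lemma e_E {R : realType} k (M : 'M[R]_3) i j : e_ k M i j = M i (inord k).
Proof. by rewrite mxE. Qed.

Theorem theorem9p5 (R : realType)
  (gam : R -> R -> 'cV[R]_3) (g : R -> R -> 'M[R]_3) (k1 k2 q r : R -> R -> R)
  (alpha1 alpha2 : R) (xi1 xi2 : R -> R -> 'cV[R]_2)
  (gam_sol : starMCF gam)
  (g_frame : adapted_null_pframe gam g k1 k2)
  (qE : forall x t, q x t = - (k1 x t / 2))
  (rE : forall x t, r x t = k2 x t / 2)
  (q_t : forall x t,
     dt q x t = - 2^-1 * (dx (dx q) x t - 2 * q x t ^+ 2 * r x t))
  (r_t : forall x t,
     dt r x t = 2^-1 * (dx (dx r) x t - 2 * q x t * r x t ^+ 2))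
  (alpha12 : alpha1 != alpha2) (alpha1_neq0 : alpha1 != 0)
  (alpha2_neq0 : alpha2 != 0)
  (xi1_sol : lax_solution q r alpha1 xi1)
  (xi2_sol : lax_solution q r alpha2 xi2)
  (xi_free : forall x t, free [:: xi1 x t; xi2 x t]) :
  let y1 x t := xi1 x t 0 0 in
  let y2 x t := xi1 x t 1 0 in
  let y3 x t := xi2 x t 0 0 in
  let y4 x t := xi2 x t 1 0 in
  let Y x t := mx2 (y1 x t) (y3 x t)
                   (y2 x t) (y4 x t) in
  let gam' x t :=
    gam x t + ((alpha1^-1 - alpha2^-1) * (\det (Y x t))^-1) *:
      (((y1 x t * y4 x t + y2 x t * y3 x t) / 2) *: e_ 0 (g x t)
       - (y1 x t * y3 x t) *: e_ 1 (g x t)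
       + (y2 x t * y4 x t) *: e_ 2 (g x t)) in
  starMCF gam'.
Proof.
have scE (v : 'cV[R]_3) a i j : (a *: v) i j = a * v i j by rewrite mxE.
move=> y1 y2 y3 y4 Y gam'.
have [Sgam _ _] := gam_sol.
have [Sg frg e0 _ _] := g_frame.
have [Sk1 Sk2] := pframe_smooth g_frame.
have k1E x t : k1 x t = - 2 * q x t by rewrite qE; field.
have k2E x t : k2 x t = 2 * r x t by rewrite rE; field.
have Sq : smooth q.
  move=> n; rewrite (_ : q = fun x t => - 2^-1 * k1 x t); last first.
    by apply: funext2 => x t; rewrite qE; field.
  by apply: class_CM; [exact: class_C_cst|exact: Sk1].
have Sr : smooth r.
  move=> n; rewrite (_ : r = fun x t => 2^-1 * k2 x t); last first.
    by apply: funext2 => x t; rewrite rE; field.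
  by apply: class_CM; [exact: class_C_cst|exact: Sk2].
have dk1E x t : dx k1 x t = - 2 * dx q x t.
  rewrite (_ : k1 = fun x t => - 2 * q x t); last exact: funext2.
  apply: dx_val; have dq := is_derive_dx x t (Sq 1%N).
  by apply: (is_derive1_eq (is_derive1M is_derive1c dq)); ring.
have dk2E x t : dx k2 x t = 2 * dx r x t.
  rewrite (_ : k2 = fun x t => 2 * r x t); last exact: funext2.
  apply: dx_val; have dr := is_derive_dx x t (Sr 1%N).
  by apply: (is_derive1_eq (is_derive1M is_derive1c dr)); ring.
have Sy i : smooth (fun x t => xi1 x t i 0).
  by move=> n; exact: (class_C_mxP.1 (lax_solution_smooth Sq Sr xi1_sol n)).
have Sz i : smooth (fun x t => xi2 x t i 0).
  by move=> n; exact: (class_C_mxP.1 (lax_solution_smooth Sq Sr xi2_sol n)).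
have Sgij i j : smooth (fun x t => g x t i j).
  by move=> n; exact: (class_C_mxP.1 (Sg n)).
have Sgami i : smooth (fun x t => gam x t i 0).
  by move=> n; exact: (class_C_mxP.1 (Sgam n)).
have D0 x t : y1 x t * y4 x t - y3 x t * y2 x t != 0.
  exact: free_det2 (xi_free x t).
pose G i j x t := g x t i (inord j).
have gamE i x t : gam' x t i 0 =
    dressed_curve alpha1 alpha2 (gam x t i 0)
      (G i 0%N x t) (G i 1%N x t) (G i 2%N x t)
      (y1 x t) (y2 x t) (y3 x t) (y4 x t).
  by rewrite /gam' det_mx2 !mxE.
(* The frame g Ad(S) along gam': its first column will turn out to be gam'_x. *)
pose F x t :=
  g x t *m darboux_Ad alpha1 alpha2 (y1 x t) (y2 x t) (y3 x t) (y4 x t).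
have frF x t : is_frame (F x t).
  by apply: is_frame_mul (frg x t) _; exact: is_frame_darboux_Ad.
pose nq x t :=
  dressed_q alpha1 alpha2 (q x t) (y1 x t) (y2 x t) (y3 x t) (y4 x t).
pose nr x t :=
  dressed_r alpha1 alpha2 (r x t) (y1 x t) (y2 x t) (y3 x t) (y4 x t).
have FE i x t := mulmx_Ad2
  (darboux11 alpha1 alpha2 (y1 x t) (y2 x t) (y3 x t) (y4 x t))
  (darboux12 alpha1 alpha2 (y1 x t) (y3 x t))
  (darboux21 alpha1 alpha2 (y2 x t) (y4 x t))
  (darboux22 alpha1 alpha2 (y1 x t) (y2 x t) (y3 x t) (y4 x t)) (g x t) i.
(* Row i of g_x = g [U, .], once the curvatures are expressed by q and r; [G_t] is likewise row i of
   g_t = g [V, .]. *)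
have G_x i x t :
  [/\ is_derive x (1 : R) ((G i 0%N)^~ t)
        (- (2 * q x t) * G i 1%N x t + 2 * r x t * G i 2%N x t),
      is_derive x (1 : R) ((G i 1%N)^~ t) (- r x t * G i 0%N x t) &
      is_derive x (1 : R) ((G i 2%N)^~ t) (q x t * G i 0%N x t)].
  have /is_derive_mxP dg := is_derive_dx x t (Sg 1%N).
  have [g0 g1 g2] := pframe_dx g_frame i x t.
  by split; apply: (is_derive1_eq (dg _ _));
    rewrite ?g0 ?g1 ?g2 ?k1E ?k2E /G; field.
have G_t i x t :
  [/\ is_derive t (1 : R) (G i 0%N x)
        (dx q x t * G i 1%N x t + dx r x t * G i 2%N x t),
      is_derive t (1 : R) (G i 1%N x)
        (- (dx r x t / 2) * G i 0%N x t - q x t * r x t * G i 1%N x t) &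
      is_derive t (1 : R) (G i 2%N x)
        (- (dx q x t / 2) * G i 0%N x t + q x t * r x t * G i 2%N x t)].
  have /is_derive_mxP dg := is_derive_dt x t (Sg 1%N).
  have [g0 g1 g2] := pframe_dt g_frame i x t.
  by split; apply: (is_derive1_eq (dg _ _));
    rewrite ?g0 ?g1 ?g2 ?dk1E ?dk2E ?k1E ?k2E /G; field.
have gam_x i x t : is_derive x (1 : R) (fun s => gam s t i 0) (G i 0%N x t).
  have /is_derive_mxP dgam := is_derive_dx x t (Sgam 1%N).
  by apply: (is_derive1_eq (dgam _ _)); rewrite -e0 e_E.
have gam_t i x t : is_derive t (1 : R) (fun s => gam x s i 0)
    (q x t * G i 1%N x t + r x t * G i 2%N x t).
  have /is_derive_mxP dgam := is_derive_dt x t (Sgam 1%N).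
  apply: (is_derive1_eq (dgam _ _)).
  by rewrite (pframe_starMCF g_frame gam_sol) k1E k2E !mxE /G; field.
have gam'_x x t : is_derive x (1 : R) (gam'^~ t) (e_ 0 (F x t)).
  apply/is_derive_mxP => i j; rewrite ord1 e_E; have [-> _ _] := FE i x t.
  under eq_fun do rewrite gamE.
  have [? ? ?] := G_x i x t.
  have [? ?] := lax_solution_dx xi1_sol x t.
  have [? ?] := lax_solution_dx xi2_sol x t.
  exact: (@is_derive_darboux_x _ _ _ alpha1_neq0 alpha2_neq0
    (fun s => gam s t i 0) ((G i 0%N)^~ t) ((G i 1%N)^~ t) ((G i 2%N)^~ t)
    (y1^~ t) (y2^~ t) (y3^~ t) (y4^~ t) (q x t) (r x t) x).
have F0_x x t : is_derive x (1 : R) (fun s => e_ 0 (F s t))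
    ((- 2 * nq x t) *: e_ 1 (F x t) + (2 * nr x t) *: e_ 2 (F x t)).
  apply/is_derive_mxP => i j; rewrite [X in is_derive _ _ _ X]mxE.
  rewrite !scE !e_E; have [_ -> ->] := FE i x t.
  rewrite (_ : (fun s => e_ 0 (F s t) i j) = fun s =>
    dressed_e0 alpha1 alpha2 (y1 s t) (y2 s t) (y3 s t) (y4 s t)
      (G i 0%N s t) (G i 1%N s t) (G i 2%N s t)); last first.
    by apply/funext => s; rewrite e_E; have [-> _ _] := FE i s t.
  have [? ? ?] := G_x i x t.
  have [? ?] := lax_solution_dx xi1_sol x t.
  have [? ?] := lax_solution_dx xi2_sol x t.
  exact: (@is_derive_darboux_xx _ _ _ alpha1_neq0 alpha2_neq0
    ((G i 0%N)^~ t) ((G i 1%N)^~ t) ((G i 2%N)^~ t)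
    (y1^~ t) (y2^~ t) (y3^~ t) (y4^~ t) (q x t) (r x t) x).
have gam'_t x t : is_derive t (1 : R) (gam' x)
    (nq x t *: e_ 1 (F x t) + nr x t *: e_ 2 (F x t)).
  apply/is_derive_mxP => i j; rewrite [X in is_derive _ _ _ X]mxE.
  rewrite !scE !e_E ord1; have [_ -> ->] := FE i x t.
  under eq_fun do rewrite gamE.
  have [? ? ?] := G_t i x t.
  have [? ?] := lax_solution_dt xi1_sol x t.
  have [? ?] := lax_solution_dt xi2_sol x t.
  exact: (@is_derive_darboux_t _ _ _ alpha1_neq0 alpha2_neq0
    (fun s => gam x s i 0) (G i 0%N x) (G i 1%N x) (G i 2%N x)
    (y1 x) (y2 x) (y3 x) (y4 x) (q x t) (r x t) (dx q x t) (dx r x t) t).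
(* An equality of functions, so that it can be rewritten under the second derivative in [Hcurv]. *)
have gam'x : dx gam' = fun x t => e_ 0 (F x t).
  by apply: funext2 => x t; exact: dx_val.
split=> [n|x t|x t].
(* Each coordinate of gam' is a rational expression in smooth functions whose only nonconstant
   denominator is det(Y), nonzero by [D0]. *)
- apply/class_C_mxP => i j; rewrite ord1 (funext2 (gamE i)) /dressed_curve.
  by do ?[exact: class_C_cst|exact: Sy|exact: Sz|exact: Sgij|exact: Sgami
    |apply: class_CD|apply: class_CN|apply: class_CM|apply: class_CV].
- by rewrite gam'x; exact: lorentz_frame0.
(* The witness is H = - 2 nq e_1 + 2 nr e_2 with its e_2 component negated; multiplied by - 1/2 it
   becomes nq e_1 + nr e_2, the value of gam'_t. *)
- exists ((- 2 * nq x t) *: e_ 1 (F x t) - (2 * nr x t) *: e_ 2 (F x t)).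
    rewrite /Hcurv gam'x (dx_val (F0_x x t)).
    by apply/hodge_star_frame.
  rewrite (dt_val (gam'_t x t)) scalerBr !scalerA -scaleNr.
  by congr (_ *: _ + _ *: _); field.
Qed.
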